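(* Let $p$ be an odd prime, $n\ge2$, $G=G_{p^{n+1}}=\langle a,b\mid a^{p^n}=1,\ b^p=1,\ b^{-1}ab=a^{p^{n-1}+1}\rangle$, and let $q$ be a prime power with $\gcd(q,p)=1$. Let $e_{p^n,k}$ be a primitive central idempotent of $\mathbb{F}_qG$ corresponding to the strong Shoda pair $(\langle a\rangle,\langle1\rangle)$, and let $\omega_0$ be the least positive integer such that $(1+p^{n-1})^{\omega_0}\in\langle q\rangle\bmod p^n$. Then: 1. $\dim_{\mathbb{F}_q}(\mathbb{F}_qG\,e_{p^n,k})=p\,o_{p^n}(q)\gcd(\omega_0,p)$. 2. The set $\mathcal{B}=\{a^{\eta_a}b^{\eta_b}e_{p^n,k}\mid 0\le\eta_a<\gcd(\omega_0,p)\,o_{p^n}(q),\ 0\le\eta_b\le p-1\}$ is an $\mathbb{F}_q$-basis of $\mathbb{F}_qG\,e_{p^n,k}$. 3. The minimum distance $d$ of $\mathbb{F}_qG\,e_{p^n,k}$ satisfies $2\le d\le p^n$ if $n\le i_0$, and $2\le d\le p^{i_0}$ otherwise.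
   Context: $o_m(q)$ is the multiplicative order of $q$ modulo $m$; $\langle q\rangle\bmod p^n$ is the subgroup of $(\mathbb{Z}/p^n)^*$ generated by $q$; $\phi$ is Euler's totient. The integer $i_0$ ($1\le i_0\le n$) is defined by $o_{p^n}(q)=\phi(p^n)/\delta$ with $\delta=p^{i_0-1}\delta'$, $\gcd(\delta',p)=1$. The minimum distance of a nonzero ideal is the minimum number of nonzero coefficients (with respect to the basis $G$) among its nonzero elements. The idempotent $e_{p^n,k}$: let $\xi$ be a primitive $p^n$-th root of unity in $\overline{\mathbb{F}}_q$, $k$ an integer coprime to $p$, and $\operatorname{tr}$ the trace from $\mathbb{F}_q(\xi)$ to $\mathbb{F}_q$. Put $\epsilon=\frac1{p^n}\sum_{i=0}^{p^n-1}\operatorname{tr}(\xi^{ki})a^{-i}$. Then $e_{p^n,k}$ is the sum of the distinct $G$-conjugates of $\epsilon$. *)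

(* Defs.v *)
From HB Require Import structures.
From mathcomp Require Import all_boot all_order all_algebra.
From mathcomp Require Import all_fingroup all_solvable all_field.

Set Implicit Arguments.
Unset Strict Implicit.
Unset Printing Implicit Defensive.

Import GRing.Theory.
Local Open Scope ring_scope.

(* The group algebra F[gT] of a whole finite group type gT: functions gT -> F
   with the convolution product. The name is new so that the product does not
   clash with the pointwise product of {ffun gT -> F}. *)
Definition galg (F : fieldType) (gT : finGroupType) := {ffun gT -> F}.

Section GroupAlgebra.
Variables (F : fieldType) (gT : finGroupType).

HB.instance Definition _ := Vector.copy (galg F gT) {ffun gT -> F^o}.

Implicit Types (x y z : galg F gT) (g h : gT).

Definition gcoef x g : F := (x : {ffun gT -> F}) g.

Definition gelt g : galg F gT := [ffun h => (h == g)%:R].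

Definition galg_mul x y : galg F gT :=
  [ffun g => \sum_h gcoef x h * gcoef y (h^-1 * g)%g].

Lemma galgP x y : gcoef x =1 gcoef y <-> x = y.
Proof. exact: ffunP. Qed.

Lemma gcoefD x y g : gcoef (x + y) g = gcoef x g + gcoef y g.
Proof. by rewrite /gcoef ffunE. Qed.

Lemma gcoefZ (c : F) x g : gcoef (c *: x) g = c * gcoef x g.
Proof. by rewrite /gcoef ffunE. Qed.

Lemma gcoef0 g : gcoef 0 g = 0.
Proof. by rewrite /gcoef ffunE. Qed.

Lemma gcoef_elt g h : gcoef (gelt g) h = (h == g)%:R.
Proof. by rewrite /gcoef ffunE. Qed.

Lemma gcoef_mul x y g :
  gcoef (galg_mul x y) g = \sum_h gcoef x h * gcoef y (h^-1 * g)%g.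
Proof. by rewrite /gcoef ffunE. Qed.

Fact galg_mulA : associative galg_mul.
Proof.
move=> x y z; apply/galgP=> g; rewrite !gcoef_mul.
under eq_bigr => h _.
  rewrite gcoef_mul mulr_sumr (reindex_inj (mulgI h^-1%g)) /=.
  under eq_bigr => i _ do rewrite invMg invgK -mulgA mulKVg mulrA.
  over.
rewrite exchange_big /=; apply: eq_bigr => i _.
by rewrite gcoef_mul mulr_suml.
Qed.

Fact galg_mul1l : left_id (gelt 1) galg_mul.
Proof.
move=> x; apply/galgP=> g; rewrite gcoef_mul (bigD1 1%g) //= big1 => [|h nh].
  by rewrite gcoef_elt eqxx mul1r invg1 mul1g addr0.
by rewrite gcoef_elt (negPf nh) mul0r.
Qed.

Fact galg_mul1r : right_id (gelt 1) galg_mul.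
Proof.
move=> x; apply/galgP=> g; rewrite gcoef_mul (bigD1 g) //= big1 => [|h nh].
  by rewrite gcoef_elt mulVg eqxx mulr1 addr0.
by rewrite gcoef_elt -eq_mulVg1 (negPf nh) mulr0.
Qed.

Fact galg_mulDl : left_distributive galg_mul +%R.
Proof.
move=> x y z; apply/galgP=> g; rewrite gcoefD !gcoef_mul -big_split /=.
by apply: eq_bigr => h _; rewrite gcoefD mulrDl.
Qed.

Fact galg_mulDr : right_distributive galg_mul +%R.
Proof.
move=> x y z; apply/galgP=> g; rewrite gcoefD !gcoef_mul -big_split /=.
by apply: eq_bigr => h _; rewrite gcoefD mulrDr.
Qed.

Fact galg_1_neq0 : gelt 1 != 0.
Proof.
apply/eqP=> /galgP/(_ 1%g)/eqP.
by rewrite gcoef_elt gcoef0 eqxx oner_eq0.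
Qed.

HB.instance Definition _ := GRing.Zmodule_isNzRing.Build (galg F gT)
  galg_mulA galg_mul1l galg_mul1r galg_mulDl galg_mulDr galg_1_neq0.

Lemma gcoefM x y g :
  gcoef (x * y) g = \sum_h gcoef x h * gcoef y (h^-1 * g)%g.
Proof. exact: gcoef_mul. Qed.

Fact galg_scaleAl (c : F) x y : c *: (x * y) = (c *: x) * y.
Proof.
apply/galgP=> g; rewrite gcoefZ !gcoefM mulr_sumr.
by apply: eq_bigr => h _; rewrite gcoefZ mulrA.
Qed.

HB.instance Definition _ :=
  GRing.Lmodule_isLalgebra.Build F (galg F gT) galg_scaleAl.

Fact galg_scaleAr (c : F) x y : c *: (x * y) = x * (c *: y).
Proof.
apply/galgP=> g; rewrite gcoefZ !gcoefM mulr_sumr.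
by apply: eq_bigr => h _; rewrite gcoefZ mulrCA.
Qed.

HB.instance Definition _ :=
  GRing.Lalgebra_isAlgebra.Build F (galg F gT) galg_scaleAr.

HB.instance Definition _ := Algebra_isFalgebra.Build F (galg F gT).

Lemma gelt1 : gelt 1 = 1. Proof. by []. Qed.

Lemma geltM g h : gelt (g * h)%g = gelt g * gelt h.
Proof.
apply/galgP=> u; rewrite gcoefM (bigD1 g) //= big1 => [|v nv].
  rewrite !gcoef_elt eqxx mul1r addr0; congr (_%:R).
  by rewrite -(inj_eq (mulgI g) (g^-1 * u)%g) mulKVg.
by rewrite gcoef_elt (negPf nv) mul0r.
Qed.

Lemma galg_sum x : x = \sum_g gcoef x g *: gelt g.
Proof.
apply/galgP=> h; rewrite /gcoef sum_ffunE (bigD1 h) //= big1 => [|g ng].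
  by rewrite !ffunE eqxx addr0 /GRing.scale /= mulr1.
by rewrite !ffunE eq_sym (negPf ng) /GRing.scale /= mulr0.
Qed.

Definition weight x : nat := #|[set g | gcoef x g != 0]|.

Definition is_min_distance (U : {vspace galg F gT}) (d : nat) : Prop :=
  (exists2 x, x \in U & x != 0 /\ weight x = d)
  /\ (forall x, x \in U -> x != 0 -> (d <= weight x)%N).

(* undup: every conjugate counts once, whatever the size of the stabiliser. *)
Definition sum_distinct_conjugates x : galg F gT :=
  \sum_(y <- undup [seq gelt g^-1 * x * gelt g | g : gT]) y.

Definition left_ideal_gen x : {vspace galg F gT} := (fullv * <[x]>)%VS.

Lemma left_ideal_genP x y :
  reflect (exists z, y = z * x) (y \in left_ideal_gen x).
Proof.
apply: (iffP idP) => [|[z ->]]; last by rewrite memv_mul ?memvf ?memv_line.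
suff /subvP sub: (left_ideal_gen x <= limg (amulr x))%VS.
  by move/sub/memv_imgP=> [z _ ->]; exists z; rewrite lfunE.
apply/prodvP=> u v _ /vlineP[c ->].
by apply/memv_imgP; exists (c *: u); rewrite ?memvf // lfunE /= -scalerAl scalerAr.
Qed.

End GroupAlgebra.

(* The Galois trace of F(xi) / F, as an element of F rather than of the line
   F.1 of L; see FtraceE. *)
Definition Ftrace (F : finFieldType) (L : splittingFieldType F) (xi y : L) : F :=
  coord [tuple (1 : L)] ord0 (galTrace 1 <<1; xi>> y).

Lemma FtraceE (F : finFieldType) (L : splittingFieldType F) (xi y : L) :
  y \in <<1; xi>>%VS -> (Ftrace xi y)%:A = galTrace 1 <<1; xi>> y.
Proof.
move=> Ey; have galE: galois 1 <<1; xi>> by exact/finField_galois/sub1v.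
have: galTrace 1 <<1; xi>> y \in <<[tuple 1%R : L]>>%VS.
  by rewrite span_seq1 (mem_galTrace galE Ey).
by move/coord_span=> E; rewrite [RHS]E big_ord1.
Qed.

(* xi ranges over the elements of splitting fields of F, as every element of
   the algebraic closure of a finite field lies in such a field. *)
Definition epsilon (F : finFieldType) (gT : finGroupType) (a : gT)
    (p n : nat) (L : splittingFieldType F) (xi : L) (k : int) : galg F gT :=
  ((p ^ n)%:R^-1 : F) *:
    \sum_(i < p ^ n) Ftrace xi (xi ^ (k * (i : nat)%:Z)) *: gelt F (a ^- i)%g.

Definition e_idem (F : finFieldType) (gT : finGroupType) (a : gT)
    (p n : nat) (L : splittingFieldType F) (xi : L) (k : int) : galg F gT :=
  sum_distinct_conjugates (epsilon a p n xi k).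

(* gT is the group with this presentation, and a, b are its two generators. *)
Definition presents_G (p n : nat) (gT : finGroupType) (a b : gT) : Prop :=
  [/\ <<[set a; b]>>%g = [set: gT],
      (a ^+ (p ^ n) = 1)%g, (b ^+ p = 1)%g,
      (b^-1 * a * b = a ^+ (p ^ n.-1 + 1))%g
    & ([set: gT] \isog
         Grp (x : y : x ^+ (p ^ n), y ^+ p, x ^ y = x ^+ (p ^ n.-1 + 1)))%g].

(* The class of c in (Z/m)^*, for 1 < m and c coprime to m. *)
Definition unit_mod (m c : nat) : {unit 'Z_m} := insubd (1%g : {unit 'Z_m}) (c%:R : 'Z_m).

Lemma val_unit_mod (m c : nat) :
  (1 < m)%N -> coprime m c -> val (unit_mod m c) = c%:R :> 'Z_m.
Proof.
by move=> m_gt1 co_mc; rewrite /unit_mod val_insubd unitZpE // co_mc.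
Qed.

Definition mult_order (m c : nat) : nat := #[unit_mod m c]%g.

(* Main.v *)
Require Import Defs.
From HB Require Import structures.
From mathcomp Require Import all_boot all_order all_algebra.
From mathcomp Require Import all_fingroup all_solvable all_field.

Set Implicit Arguments.
Unset Strict Implicit.
Unset Printing Implicit Defensive.

Import GRing.Theory.
Local Open Scope ring_scope.

(* The conjugates of the character a |-> xi^k of <a> under the Frobenius map
   x |-> x^q and under b, which acts by x |-> x^(1 + p^(n-1)), are the characters
   a |-> xi^(k u) with u in the product of the subgroups generated by q and by
   1 + p^(n-1) in (Z/p^n)^*.  The element e of F<a> takes the value 1 at these
   characters and 0 at all others, so F<a>e has dimension the order of that product
   and basis the first powers of a times e (a degree count).  Since e is central,
   FGe is the direct sum of the F<a>e b^j.
   Elements of FGe have coefficient sum 0 because e kills the trivial character,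
   so their weight is at least 2.  The upper bounds are witnessed by e itself:
   when i0 < n, the subgroup generated by q contains all 1 + p^i0 t, and
   averaging the trace of xi^(k i) over these makes it vanish unless p^(n-i0)
   divides i. *)

(** * Sums of indicators and powers of primitive roots *)

(** At most one entry satisfies [Q], so at most one term is nonzero. This evaluates the sum of the
    distinct conjugates at a single character. *)
Lemma sum_indicator_uniq (R : pzSemiRingType) (T : eqType) (s : seq T) (Q : pred T) :
  uniq s -> {in s &, forall y y', Q y -> Q y' -> y = y'} ->
  \sum_(y <- s) (Q y)%:R = (has Q s)%:R :> R.
Proof.
elim: s => [|y s IHs] /=; first by rewrite big_nil.
case/andP=> s'y uniq_s inj; rewrite big_cons.
have [Qy|nQy] /= := boolP (Q y); last first.
  by rewrite add0r IHs // => u v su sv; apply: inj; rewrite inE ?su ?sv orbT.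
rewrite big_seq big1 ?addr0 // => u su; case Qu: (Q u) => //.
by move: s'y; rewrite (inj y u) ?su // inE ?eqxx // su orbT.
Qed.

Lemma uniq_prim_powers (R : nzRingType) (m : nat) (z : R) :
  m.-primitive_root z -> uniq [seq z ^+ i | i <- index_iota 0 m].
Proof.
move=> z_prim; rewrite map_inj_in_uniq ?iota_uniq // => i j.
rewrite !mem_index_iota /= => im jm /eqP.
by rewrite (eq_prim_root_expr z_prim) !modn_small // => /eqP.
Qed.

(** * Units modulo m acting on the m-th roots of unity *)

Section UnitsModulo.

Variable m : nat.
Hypothesis m_gt1 : (1 < m)%N.

Lemma val_unit_modE c :
  coprime m c -> ((val (unit_mod m c) : 'Z_m) : nat) = (c %% m)%N.
Proof. by move=> co_mc; rewrite val_unit_mod // val_Zp_nat. Qed.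

Lemma val_unitM_mod (u v : {unit 'Z_m}) :
  ((val (u * v)%g : 'Z_m) : nat) = ((val u : 'Z_m) * (val v : 'Z_m) %% m)%N.
Proof. by rewrite FinRing.val_unitM /=; congr (_ %% _)%N; apply: Zp_cast. Qed.

Lemma unit_modX c t : coprime m c -> (unit_mod m c ^+ t)%g = unit_mod m (c ^ t).
Proof.
move=> co_mc; apply: val_inj; rewrite FinRing.val_unitX !val_unit_mod ?coprimeXr //.
by rewrite natrX.
Qed.

Lemma unit_mod_eq1 c : coprime m c -> (unit_mod m c == 1%g) = (c == 1 %[mod m]).
Proof.
move=> co_mc; rewrite -(inj_eq val_inj) -(inj_eq val_inj).
rewrite [val (val (unit_mod m c))]val_unit_modE //.
by rewrite (modn_small m_gt1).
Qed.

Variables (R : idomainType) (z : R).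
Hypothesis z_prim : m.-primitive_root z.

(** If [z] is the value at a generator of a faithful character of a cyclic group of order m, these
    are the values there of all its faithful characters. *)
Definition unit_root (u : {unit 'Z_m}) : R := z ^+ (val u : 'Z_m).

Lemma unit_root1 : unit_root 1%g = z.
Proof. by rewrite /unit_root FinRing.val_unit1 /= expr1. Qed.

Lemma unit_rootM u v : unit_root (u * v)%g = unit_root u ^+ (val v : 'Z_m).
Proof.
by rewrite /unit_root val_unitM_mod -exprM (prim_expr_mod z_prim).
Qed.

Lemma unit_root_inj : injective unit_root.
Proof.
move=> u v /eqP; rewrite /unit_root (eq_prim_root_expr z_prim) => /eqP E.
apply/val_inj/val_inj; move: E; rewrite !modn_small //.
  by case: (val v : 'Z_m) => i /=; rewrite Zp_cast.
by case: (val u : 'Z_m) => i /=; rewrite Zp_cast.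
Qed.

Lemma unit_root_expr u : unit_root u ^+ m = 1.
Proof. by rewrite -exprM mulnC exprM (prim_expr_order z_prim) expr1n. Qed.

Lemma sum_unit_root x (B : {set {unit 'Z_m}}) :
  \sum_(u in B) (unit_root u == x)%:R = (x \in image unit_root B)%:R :> R.
Proof.
rewrite -big_enum sum_indicator_uniq ?enum_uniq //=.
  by congr (_%:R); rewrite -has_pred1 has_map; congr (nat_of_bool _).
by move=> u v _ _ /eqP<- /eqP/unit_root_inj.
Qed.

Lemma image_unit_root_uniq (B : {set {unit 'Z_m}}) : uniq (image unit_root B).
Proof.
by rewrite map_inj_in_uniq ?enum_uniq // => u v _ _; apply: unit_root_inj.
Qed.

Lemma image_unit_root_expr (B : {set {unit 'Z_m}}) x :
  x \in image unit_root B -> x ^+ m = 1.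
Proof. by case/imageP=> u _ ->; apply: unit_root_expr. Qed.

Lemma unit_root_neq1 u : unit_root u != 1.
Proof.
apply/eqP=> E; have := unit_rootM u u^-1%g.
rewrite mulgV unit_root1 E expr1n => z1; have := prim_order_dvd z_prim 1%N.
by rewrite z1 expr1n eqxx dvdn1 gtn_eqF.
Qed.

Lemma unit_rootM_mod u c :
  coprime m c -> unit_root (u * unit_mod m c)%g = unit_root u ^+ c.
Proof.
by move=> co_mc; rewrite unit_rootM val_unit_modE // (expr_mod _ (unit_root_expr u)).
Qed.

(** The map x -> x^u permutes the m-th roots of unity and sends z^v to z^(vu), so taking preimages
    translates exponent sets by u^-1. *)
Lemma mem_unit_rootX (A : {set {unit 'Z_m}}) (u : {unit 'Z_m}) (x : R) : x ^+ m = 1 ->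
  (x ^+ (val u : 'Z_m) \in image unit_root A) =
  (x \in image unit_root (A :* u^-1)%g).
Proof.
move=> xm1; apply/imageP/imageP=> [[v Av E]|[v]].
  exists (v * u^-1)%g; first by rewrite mem_rcoset invgK mulgKV.
  rewrite unit_rootM -E -exprM -[LHS]expr1.
  have x1 a b : (a = b %[mod m])%N -> x ^+ a = x ^+ b.
    by move=> ab; rewrite -(expr_mod _ xm1) ab expr_mod.
  by apply: x1; rewrite -val_unitM_mod mulgV modn_small.
rewrite mem_rcoset invgK => Avu ->; exists (v * u)%g => //.
by rewrite unit_rootM.
Qed.

End UnitsModulo.

(** * The unit group modulo an odd prime power *)

Section PrimePowerUnits.

Variables (p n : nat).
Hypotheses (p_pr : prime p) (p_odd : odd p) (n_ge2 : (2 <= n)%N).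

Local Notation P := (p ^ n)%N.

Lemma pfactor_gt1 : (1 < P)%N.
Proof. by rewrite -(exp1n n) ltn_exp2r ?prime_gt1 // (ltn_trans _ n_ge2). Qed.

(** The units are the automorphisms of the additive group Z/p^n. The structure theorem for
    automorphisms of a cyclic p-group has a cyclic branch, selected by p being odd. *)
Lemma units_Z_pfactor_cyclic : cyclic [set: {unit 'Z_P}].
Proof.
have P_gt1 := pfactor_gt1.
pose x : 'Z_P := Zp1; have ox : #[x]%g = P by rewrite order_Zp1 Zp_cast.
suff : cyclic (units_Zp #[x]%g) by rewrite ox.
rewrite (isog_cyclic (Zp_unit_isog x)).
have cycX : cyclic <[x]>%g by apply: cycle_cyclic.
have pX : (p.-group <[x]>)%g by rewrite /pgroup -orderE ox pnatX pnat_id.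
have ntX : <[x]>%g != 1%g by rewrite -cardG_gt1 -orderE ox.
have [/= m []] := cyclic_pgroup_Aut_structure pX cycX ntX.
have -> : logn p #|<[x]>%g| = n by rewrite -orderE ox pfactorK.
have /negPf-> : n.-1 != 0%N by case: n n_ge2 => [|[|]].
move=> _ _ [t [_ _ _]].
by rewrite p_odd => -[[]].
Qed.

Lemma units_Z_pfactor_abelian : abelian [set: {unit 'Z_P}].
Proof. exact: cyclic_abelian units_Z_pfactor_cyclic. Qed.

(** Factor y^p - 1 as (y - 1) times the sum of p powers of y: p^k divides the first factor, and each
    of the p powers is 1 modulo p. *)
Lemma expn_p_mod k y :
  (0 < k)%N -> (y = 1 %[mod p ^ k])%N -> (y ^ p = 1 %[mod p ^ k.+1])%N.
Proof.
move=> k_gt0 y1; have p_gt1 := prime_gt1 p_pr.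
have pk_gt1 : (1 < p ^ k)%N by rewrite -(exp1n k) ltn_exp2r.
have y_gt0 : (0 < y)%N.
  by case: y y1 => // /eqP; rewrite mod0n modn_small.
apply/eqP; rewrite eqn_mod_dvd ?expn_gt0 ?y_gt0 // -{1}(exp1n p) subn_exp expnSr.
apply: dvdn_mul; first by rewrite -eqn_mod_dvd //; apply/eqP.
have y1p : (y = 1 %[mod p])%N.
  by apply/eqP; rewrite eqn_mod_dvd // (dvdn_trans (dvdn_exp k_gt0 (dvdnn p))) //
     -eqn_mod_dvd //; apply/eqP.
rewrite /dvdn -modn_summ (eq_bigr (fun=> 1%N)) => [|l _].
  by rewrite sum_nat_const card_ord muln1 modnn.
by rewrite exp1n muln1 -modnXm y1p modnXm exp1n modn_small.
Qed.

Lemma expn_pX_mod k y j :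
  (0 < k)%N -> (y = 1 %[mod p ^ k])%N -> (y ^ (p ^ j) = 1 %[mod p ^ (k + j)])%N.
Proof.
move=> k_gt0 y1; elim: j => [|j IHj]; first by rewrite addn0 expn1.
by rewrite addnS expnSr expnM; apply: expn_p_mod => //; rewrite addn_gt0 k_gt0.
Qed.

Lemma coprime_1add i c : (0 < i)%N -> coprime P (1 + p ^ i * c).
Proof.
move=> i_gt0; apply: coprimeXl; rewrite -(prednK i_gt0) expnS -mulnA mulnC addnC.
by rewrite -coprime_modr modnMDl coprime_modr coprimen1.
Qed.

(* For odd [p] the unit group is cyclic, so a cyclic subgroup contains every
   unit whose order divides its own. *)
Lemma mem_cycle_1add i c (w : {unit 'Z_P}) :
  (0 < i <= n)%N -> (p ^ (n - i) %| #[w]%g)%N ->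
  unit_mod P (1 + p ^ i * c) \in <[w]>%g.
Proof.
move=> /andP[i_gt0 le_in] dvd_w; rewrite -cycle_subG.
rewrite -(cardSg_cyclic units_Z_pfactor_cyclic) ?subsetT //.
apply: dvdn_trans dvd_w; rewrite -orderE order_dvdn.
rewrite unit_modX ?unit_mod_eq1 ?coprimeXr ?coprime_1add ?pfactor_gt1 //.
apply/eqP; have := @expn_pX_mod i (1 + p ^ i * c) (n - i) i_gt0.
by rewrite subnKC // => -> //; rewrite addnC mulnC modnMDl.
Qed.

End PrimePowerUnits.

(** * Frobenius and the trace of a root of unity *)

Lemma big_cycle (V : nmodType) (hT : finGroupType) (g : hT) (f : hT -> V) :
  \sum_(x in <[g]>%g) f x = \sum_(i < #[g]%g) f (g ^+ i)%g.
Proof.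
have -> : <[g]>%g = [set (g ^+ (i : nat))%g | i : 'I_#[g]%g].
  apply/setP=> x; apply/idP/imsetP=> [/cyclePmin[i lt_i ->]|[i _ ->]].
    by exists (Ordinal lt_i).
  exact: mem_cycle.
rewrite big_imset //= => i j _ _ /eqP.
by rewrite eq_expg_mod_order !modn_small // => /eqP/val_inj.
Qed.

(** The Galois group of F(xi)/F is generated by the Frobenius map [alpha]. Its t-th power is trivial
    exactly when it fixes xi, that is when q^t = 1 mod m, so [alpha] has the order of q modulo m and
    both sums run over the same powers of y. *)
Lemma Ftrace_root (F : finFieldType) (L : splittingFieldType F) (m : nat)
    (xi y : L) :
  (1 < m)%N -> coprime m #|F| -> m.-primitive_root xi -> y ^+ m = 1 ->
  (Ftrace xi y)%:A =
    \sum_(u in <[unit_mod m #|F|]>%g) y ^+ (val u : 'Z_m) :> L.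
Proof.
move=> m_gt1 co_mq xi_prim ym1; pose E := <<1; xi>>%AS.
have Exi : xi \in E by apply: memv_adjoin.
have Ey : y \in E by have [i ->] := prim_rootP xi_prim ym1; apply: rpredX.
rewrite FtraceE // /galTrace.
have [alpha] := finField_galois_generator (sub1v E).
move/eqP=> defG Da; rewrite [in LHS]defG !big_cycle.
have Dat t x : x \in E -> (alpha ^+ t)%g x = x ^+ (#|F| ^ t).
  elim: t x => [|t IHt] x Ex; first by rewrite gal_id.
  rewrite expgSr galM // IHt // rmorphXn /= Da // dimv1 expn1.
  by rewrite -exprM mulnC -expnSr.
have oa : #[alpha]%g = #[unit_mod m #|F|]%g.
  have E1 t : (alpha ^+ t == 1)%g = (unit_mod m #|F| ^+ t == 1)%g.
    rewrite unit_modX // unit_mod_eq1 ?coprimeXr // -(eq_prim_root_expr xi_prim).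
    rewrite expr1 -Dat //.
    have := @gal_adjoin_eq _ _ 1%AS xi (alpha ^+ t)%g 1%g.
    rewrite gal_id => -> //.
    by rewrite defG mem_cycle.
  by apply/eqP; rewrite eqn_dvd !order_dvdn -E1 expg_order E1 expg_order !eqxx.
rewrite oa; apply: eq_bigr => i _; rewrite Dat // unit_modX //.
by rewrite val_unit_modE ?coprimeXr // (expr_mod _ ym1).
Qed.

(** * Structure of the presented group *)

Section Presentation.

Variables (p n : nat) (gT : finGroupType) (a b : gT).
Hypotheses (p_pr : prime p) (n_ge2 : (2 <= n)%N) (G_pres : presents_G p n a b).

Local Notation P := (p ^ n)%N.

Lemma presents_G_exprj j : (a ^ (b ^+ j) = a ^+ ((1 + p ^ n.-1) ^ j))%g.
Proof.
have [_ _ _ ab _] := G_pres; elim: j => [|j IHj]; first by rewrite conjg1.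
rewrite expgSr conjgM IHj conjXg /conjg mulgA ab -expgM addnC mulnC.
by rewrite -expnSr.
Qed.

Lemma presents_G_mul : (<[a]> * <[b]>)%g = [set: gT].
Proof.
have [gen _ _ ab _] := G_pres.
have nab : <[b]>%g \subset 'N(<[a]>%g)%g.
  rewrite cycle_subG; apply/normP/eqP; rewrite eqEcard cardJg leqnn andbT.
  by rewrite -cycleJ cycle_subG -[b]expg1 presents_G_exprj mem_cycle.
by rewrite -norm_joinEr // joing_idl joing_idr -[RHS]gen.
Qed.

Lemma presents_G_conj g : exists j, (a ^ g = a ^+ ((1 + p ^ n.-1) ^ j))%g.
Proof.
have /mulsgP[_ _ /cycleP[i ->] /cycleP[j ->] ->] : g \in (<[a]> * <[b]>)%g.
  by rewrite presents_G_mul inE.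
exists j; rewrite conjgM -presents_G_exprj; congr (_ ^ _)%g.
exact/conjg_fixP/commgP/commuteX.
Qed.

(** The relations bound the orders of a and b by p^n and p. The presentation makes G surject onto
    the modular group of order p^(n+1), so the product formula for [<[a]>] and [<[b]>] forces
    equality everywhere. *)
Lemma presents_G_orders :
  [/\ #[a]%g = P, #[b]%g = p & (<[a]> :&: <[b]> = 1)%g].
Proof.
have [_ aP bp _ isoG] := G_pres.
have dvd_a : (#[a]%g %| P)%N by rewrite order_dvdn aP.
have dvd_b : (#[b]%g %| p)%N by rewrite order_dvdn bp.
have P_gt0 : (0 < P)%N by rewrite expn_gt0 prime_gt0.
have leG : (P * p <= #|(<[a]> * <[b]>)%g|)%N.
  have n1_gt2 : (2 < n.+1)%N by [].
  have isoM := Grp_modular_group p_pr n1_gt2.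
  have: ([set: 'Mod_(p ^ n.+1)] \homg [set: gT])%g.
    rewrite isoG addn1; have := isoM _ [set: 'Mod_(p ^ n.+1)]%G.
    by rewrite /= => <-; apply: homg_refl.
  move/leq_homg; rewrite presents_G_mul card_modular_group //.
  by rewrite expnSr.
have := mul_cardG <[a]>%g <[b]>%g; rewrite -!orderE.
have le_a := dvdn_leq P_gt0 dvd_a; have le_b := dvdn_leq (prime_gt0 p_pr) dvd_b.
have I_gt0 : (0 < #|(<[a]> :&: <[b]>)%g|)%N by apply: cardG_gt0.
set I := (#|(<[a]> :&: <[b]>)%g|)%N in I_gt0 *.
set AB := (#|(<[a]> * <[b]>)%g|)%N in leG *.
move=> E.
have le_Pp : (#[a]%g * #[b]%g <= P * p)%N by apply: leq_mul.
have ABI : (P * p <= AB * I)%N.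
  by rewrite (leq_trans leG) // leq_pmulr.
have Eab : (#[a]%g * #[b]%g = P * p)%N.
  by apply/eqP; rewrite eqn_leq le_Pp E.
have Ppgt0 : (0 < P * p)%N by rewrite muln_gt0 P_gt0 prime_gt0.
have I1 : I = 1%N.
  apply/eqP; rewrite eqn_leq I_gt0 andbT -(leq_pmul2l Ppgt0) muln1.
  by rewrite -{2}Eab E leq_mul2r leG orbT.
have ea : #[a]%g = P.
  apply/eqP; rewrite eqn_leq le_a /= -(leq_pmul2r (prime_gt0 p_pr)) -Eab.
  by rewrite leq_mul2l le_b orbT.
split=> //.
  by apply/eqP; rewrite -(eqn_pmul2l P_gt0) -{1}ea Eab.
by apply/eqP; rewrite trivg_card1 -/I I1.
Qed.

End Presentation.

(** * Coefficients in the group algebra *)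

Section GroupAlgebra.

Variables (F : fieldType) (gT : finGroupType).
Implicit Types (x y : galg F gT) (g h : gT).

Lemma gelt_expg g i : gelt F (g ^+ i)%g = gelt F g ^+ i.
Proof. by elim: i => [|i IHi] //; rewrite expgS geltM IHi exprS. Qed.

Lemma gcoef_sum (I : Type) (r : seq I) (Q : pred I) (y : I -> galg F gT) g :
  gcoef (\sum_(i <- r | Q i) y i) g = \sum_(i <- r | Q i) gcoef (y i) g.
Proof. by elim/big_rec2: _ => [|i u v _ <-]; rewrite ?gcoef0 ?gcoefD. Qed.

Lemma gcoef_mul_elt x h g : gcoef (x * gelt F h) g = gcoef x (g * h^-1)%g.
Proof.
rewrite gcoefM (bigD1 (g * h^-1)%g) //= big1 ?addr0 => [|u nu].
  by rewrite gcoef_elt invMg invgK mulgKV eqxx mulr1.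
rewrite gcoef_elt; case: eqP => [uh|_]; last by rewrite mulr0.
by rewrite -uh invMg invgK mulKVg eqxx in nu.
Qed.

(** The coefficient sum is the augmentation map, a ring homomorphism. *)
Lemma sum_gcoefM x y :
  \sum_g gcoef (x * y) g = (\sum_g gcoef x g) * \sum_g gcoef y g.
Proof.
under eq_bigr do rewrite gcoefM.
rewrite exchange_big mulr_suml; apply: eq_bigr => h _ /=.
by rewrite -mulr_sumr; congr (_ * _); rewrite [RHS](reindex_inj (mulgI h^-1%g)).
Qed.

Lemma weight_leq x (B : {set gT}) :
  (forall g, gcoef x g != 0 -> g \in B) -> (weight x <= #|B|)%N.
Proof.
by move=> xB; apply/subset_leq_card/subsetP=> g; rewrite inE; apply: xB.
Qed.

End GroupAlgebra.

(** * The subalgebra F<a>, through polynomials in a and characters *)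

Section CyclicSubalgebra.

Variables (F : fieldType) (gT : finGroupType) (a : gT) (P : nat).
Hypothesis order_a : #[a]%g = P.

Local Notation A := (horner_alg (gelt F a)).

Lemma horner_geltE f : A f = \sum_(i < size f) f`_i *: gelt F (a ^+ i)%g.
Proof.
rewrite -{1}[f]coefK poly_def linear_sum; apply: eq_bigr => i _.
by rewrite linearZ rmorphXn /= horner_algX gelt_expg mulr_algl.
Qed.

Lemma gcoef_horner_out f g : g \notin <[a]>%g -> gcoef (A f) g = 0.
Proof.
move=> a'g; rewrite horner_geltE gcoef_sum big1 // => i _.
rewrite gcoefZ gcoef_elt; case: eqP => [gai|_]; last by rewrite mulr0.
by rewrite gai mem_cycle in a'g.
Qed.

Lemma conj_horner f g r : (a ^ g = a ^+ r)%g ->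
  gelt F g^-1 * A f * gelt F g = A (f \Po 'X^r).
Proof.
move=> ag; rewrite comp_polyE linear_sum horner_geltE mulr_sumr mulr_suml.
apply: eq_bigr => i _; rewrite linearZ rmorphXn /= rmorphXn /= horner_algX mulr_algl.
rewrite -scalerAr -scalerAl -!geltM -!gelt_expg -ag -conjXg /conjg.
by rewrite mulgA.
Qed.

Variables (L : fieldType) (iota : {rmorphism F -> L}).

(* On F<a> this is the character a |-> x; coefficients outside <a> are ignored. *)
Definition galg_eval (x : L) (y : galg F gT) : L :=
  \sum_(i < P) iota (gcoef y (a ^+ i)%g) * x ^+ i.

Lemma galg_eval_sum x (I : Type) (r : seq I) (Q : pred I) (y : I -> galg F gT) :
  galg_eval x (\sum_(i <- r | Q i) y i) = \sum_(i <- r | Q i) galg_eval x (y i).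
Proof.
rewrite /galg_eval exchange_big; apply: eq_bigr => i _ /=.
by rewrite gcoef_sum rmorph_sum mulr_suml.
Qed.

Lemma galg_evalZ x c y : galg_eval x (c *: y) = iota c * galg_eval x y.
Proof.
rewrite /galg_eval mulr_sumr; apply: eq_bigr => i _.
by rewrite gcoefZ rmorphM mulrA.
Qed.

Lemma galg_eval_elt x i : x ^+ P = 1 -> galg_eval x (gelt F (a ^+ i)%g) = x ^+ i.
Proof.
have P_gt0 : (0 < P)%N by rewrite -order_a order_gt0.
move=> xP1; rewrite /galg_eval (bigD1 (Ordinal (ltn_pmod i P_gt0))) //= big1.
  rewrite addr0 gcoef_elt eq_expg_mod_order order_a modn_mod eqxx rmorph1 mul1r.
  exact: expr_mod.
move=> j nj; rewrite gcoef_elt eq_expg_mod_order order_a modn_small //.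
suff /negPf-> : (j : nat) != (i %% P)%N by rewrite rmorph0 mul0r.
by apply: contra nj => /eqP ji; apply/eqP/val_inj.
Qed.

Lemma galg_eval_horner x f : x ^+ P = 1 -> galg_eval x (A f) = (map_poly iota f).[x].
Proof.
move=> xP1; rewrite horner_geltE galg_eval_sum horner_coef.
rewrite size_map_poly; apply: eq_bigr => i _.
by rewrite galg_evalZ galg_eval_elt // coef_map.
Qed.

Variable z : L.
Hypothesis z_prim : P.-primitive_root z.

(** Over [L] the polynomial X^P - 1 splits into distinct linear factors, and divisibility descends
    from [L] to [F]. *)
Lemma dvdp_Xn_sub_1 (f : {poly F}) :
  (forall x, x ^+ P = 1 -> root (map_poly iota f) x) -> 'X^P - 1 %| f.
Proof.
move=> rf; rewrite -(dvdp_map iota) rmorphB rmorph1 /= map_polyXn.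
rewrite -(factor_Xn_sub_1 z_prim).
rewrite -(big_map (fun i => z ^+ i) xpredT (fun x => 'X - x%:P)).
apply: uniq_roots_dvdp.
  apply/allP=> _ /mapP[i _ ->]; apply: rf.
  by rewrite exprAC (prim_expr_order z_prim) expr1n.
by rewrite uniq_rootsE uniq_prim_powers.
Qed.

Lemma expgN_sub i : (i <= P)%N -> (a ^- i = a ^+ (P - i))%g.
Proof.
move=> le_iP; apply/eqP.
by rewrite eq_sym eq_mulgV1 invgK -expgD subnK // -order_a expg_order.
Qed.

Lemma horner_gelt_Xn_sub_1 : A ('X^P - 1) = 0.
Proof.
rewrite rmorphB rmorph1 rmorphXn /= horner_algX -gelt_expg -order_a.
by rewrite expg_order subrr.
Qed.

Lemma horner_gelt_eq0 f :
  (forall x, x ^+ P = 1 -> (map_poly iota f).[x] = 0) -> A f = 0.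
Proof.
move=> f0; have /dvdpP[g ->] : 'X^P - 1 %| f.
  by apply: dvdp_Xn_sub_1 => x /f0/rootP.
by rewrite rmorphM /= horner_gelt_Xn_sub_1 mulr0.
Qed.

(** Elements of F<a> are determined by their character values: a difference vanishing at every P-th
    root of unity comes from a multiple of X^P - 1, which a kills. *)
Lemma horner_gelt_inj f g :
  (forall x, x ^+ P = 1 -> galg_eval x (A f) = galg_eval x (A g)) -> A f = A g.
Proof.
move=> fg; apply/eqP; rewrite -subr_eq0 -rmorphB; apply/eqP.
apply: horner_gelt_eq0 => x xP1; rewrite rmorphB hornerD hornerN.
by rewrite -!galg_eval_horner // fg // subrr.
Qed.

End CyclicSubalgebra.

(** * Orthogonality, powers of primitive roots, and a dimension bound *)

Lemma sum_expr_root1 (R : idomainType) (m : nat) (w : R) :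
  w ^+ m = 1 -> \sum_(i < m) w ^+ i = (w == 1)%:R * m%:R.
Proof.
move=> wm1; have [->|w1] := eqVneq w 1.
  rewrite mul1r (eq_bigr (fun=> 1)) => [|i _]; last by rewrite expr1n.
  by rewrite sumr_const card_ord.
have : (w - 1) * (\sum_(i < m) w ^+ i) = 0 by rewrite -subrX1 wm1 subrr.
by rewrite mul0r => /eqP; rewrite mulf_eq0 subr_eq0 (negPf w1) => /eqP.
Qed.

Lemma exprz_prim_root (K : fieldType) (m : nat) (xi : K) (k : int) :
  m.-primitive_root xi -> coprimez k m%:Z -> m.-primitive_root (xi ^ k).
Proof.
move=> xi_prim; have m_gt0 := prim_order_gt0 xi_prim.
rewrite /coprimez /gcdz /= => /eqP[/eqP].
case: k => j /= co; first by rewrite -exprnP (prim_root_exp_coprime _ xi_prim).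
rewrite NegzE -exprnN.
have pr : m.-primitive_root (xi ^+ j.+1).
  by rewrite (prim_root_exp_coprime _ xi_prim).
(* For negative k, the inverse is the power with exponent m - 1, which is coprime to m. *)
have -> : (xi ^+ j.+1)^-1 = (xi ^+ j.+1) ^+ m.-1.
  apply: (mulfI (x := xi ^+ j.+1)); first by rewrite (prim_root_eq0 pr) -lt0n.
  by rewrite -exprS prednK // (prim_expr_order pr) divff // (prim_root_eq0 pr) -lt0n.
by rewrite (prim_root_exp_coprime _ pr) coprime_sym coprimenP.
Qed.

Lemma leq_dim_free_family (K : fieldType) (V : vectType K) (I : finType)
    (v : I -> V) (U : {vspace V}) :
  (forall i, v i \in U) ->
  (forall c : I -> K, \sum_i c i *: v i = 0 -> forall i, c i = 0) ->
  (#|I| <= \dim U)%N.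
Proof.
move=> vU free_v; pose X := [tuple v (enum_val i) | i < #|I|].
have freeX : free X.
  apply/freeP=> c S0 i; pose c' i := c (enum_rank i).
  have := free_v c' _ (enum_val i); rewrite /c' enum_valK; apply.
  rewrite -[RHS]S0 (reindex _ (onW_bij _ (enum_val_bij I))) /=.
  by apply: eq_bigr => j _; rewrite enum_valK nth_mktuple.
rewrite -[X in (X <= _)%N](size_tuple X) -(eqP freeX) dimvS //.
by apply/span_subvP=> _ /imageP[i _ ->].
Qed.

(** * Character values of the idempotent and its multiples in F<a> *)

Section Idempotent.

Variables (p n : nat) (F : finFieldType) (gT : finGroupType) (a b : gT).
Variables (L : splittingFieldType F) (xi : L) (k : int).
Hypotheses (p_pr : prime p) (p_odd : odd p) (n_ge2 : (2 <= n)%N).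
Hypotheses (G_pres : presents_G p n a b) (co_qp : coprime #|F| p).
Hypotheses (xi_prim : (p ^ n).-primitive_root xi) (co_kp : coprimez k p%:Z).

Local Notation P := (p ^ n)%N.
Local Notation z := (xi ^ k).
Local Notation A := (horner_alg (gelt F a)).
Local Notation inF := (in_alg L : {rmorphism F -> L}).
Local Notation ev := (galg_eval a P (in_alg L)).
Local Notation r := (1 + p ^ n.-1)%N.
Local Notation N := (<[unit_mod P #|F|]>%g).
Local Notation H := (<[unit_mod P r]>%g).
Local Notation E := (unit_root z).
Local Notation eps := (epsilon a p n xi k : galg F gT).
Local Notation e := (e_idem a p n xi k : galg F gT).

Let P_gt1 : (1 < P)%N := pfactor_gt1 p_pr n_ge2.
Let P_gt0 : (0 < P)%N := ltnW P_gt1.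
Let order_a : #[a]%g = P.
Proof. by have [] := presents_G_orders p_pr n_ge2 G_pres. Qed.

Lemma exprz_xi_prim : P.-primitive_root z.
Proof.
apply: exprz_prim_root => //; rewrite /coprimez /gcdz /=.
move: co_kp; rewrite /coprimez /gcdz /= => /eqP[/eqP co].
by apply/eqP; congr Posz; apply/eqP; apply: coprimeXr.
Qed.
Let zP1 : z ^+ P = 1 := prim_expr_order exprz_xi_prim.

Let co_Pq : coprime P #|F|. Proof. by rewrite coprime_sym coprimeXr. Qed.
Let co_Pr : coprime P r.
Proof.
by have := @coprime_1add p n n.-1 1; rewrite muln1; apply; case: n n_ge2 => [|[]].
Qed.

(** This is p^n times the coefficient of [a ^- i] in [epsilon]. *)
Definition root_trace i : F := Ftrace xi (z ^+ i).

Lemma root_traceE i : (root_trace i)%:A = \sum_(u in N) E u ^+ i :> L.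
Proof.
have ziP : (z ^+ i) ^+ P = 1 by rewrite exprAC zP1 expr1n.
rewrite /root_trace (Ftrace_root P_gt1 co_Pq xi_prim ziP).
by apply: eq_bigr => u _; rewrite /unit_root exprAC.
Qed.

(** The inverse powers of a are written with exponent P - i; the term i = 0 becomes X^P, which still
    evaluates to the identity at a. *)
Definition epsilon_poly : {poly F} :=
  P%:R^-1 *: \sum_(i < P) root_trace i *: 'X^(P - i).

Lemma epsilon_horner : eps = A epsilon_poly.
Proof.
rewrite /epsilon_poly linearZ linear_sum /= mulr_algl; congr (_ *: _).
apply: eq_bigr => i _; rewrite linearZ /= mulr_algl rmorphXn /= horner_algX.
congr (_ *: _); first by rewrite /root_trace -exprz_exp.
by rewrite -gelt_expg (expgN_sub order_a) // ltnW.
Qed.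

(** Expanding the traces gives 1/P times the sum over u in [N] and i < P of (z^u / x)^i. By
    orthogonality the inner sum is P if x = z^u and 0 otherwise. *)
Lemma galg_eval_epsilon x : x ^+ P = 1 -> ev x eps = (x \in image E N)%:R.
Proof.
move=> xP1; rewrite -(sum_unit_root P_gt1 exprz_xi_prim) galg_evalZ fmorphV rmorph_nat.
rewrite galg_eval_sum.
have P_neq0 : P%:R != 0 :> L by apply: prim_root_natf_neq0 xi_prim.
have x0 : x != 0.
  apply/eqP=> x0; move/eqP: xP1.
  by rewrite x0 expr0n gtn_eqF // eq_sym oner_eq0.
apply: (mulfI P_neq0); rewrite mulVKf // mulr_sumr.
transitivity (\sum_(i < P) \sum_(u in N) (E u / x) ^+ i).
  apply: eq_bigr => i _; rewrite galg_evalZ.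
  have -> : Ftrace xi (xi ^ (k * (i : nat)%:Z)) = root_trace i.
    by rewrite /root_trace -exprz_exp.
  rewrite (expgN_sub order_a) ?(ltnW (ltn_ord i)) //.
  rewrite galg_eval_elt //= root_traceE mulr_suml; apply: eq_bigr => u _.
  rewrite exprMn; congr (_ * _); rewrite exprVn; apply: (mulIf (expf_neq0 i x0)).
  by rewrite -exprD subnK ?(ltnW (ltn_ord i)) // xP1 mulVf // expf_neq0.
rewrite exchange_big; apply: eq_bigr => u _ /=; rewrite sum_expr_root1.
  by rewrite mulrC (can2_eq (divfK x0) (mulfK x0)) mul1r.
by rewrite exprMn exprVn xP1 (unit_root_expr exprz_xi_prim) mul1r invr1.
Qed.

Lemma mulg_unit_cycles : (N * H)%g = (N <*> H)%g.
Proof.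
rewrite cent_joinEr //; apply: sub_abelian_cent2
  (units_Z_pfactor_abelian p_pr p_odd n_ge2) _ _; exact: subsetT.
Qed.

(** Conjugation substitutes a^(r^j) for a, hence evaluates at x^(r^j); [mem_unit_rootX] turns this
    into a translation of the support. *)
Lemma galg_eval_conj (f : {poly F}) (B : {set {unit 'Z_P}}) g j :
  (a ^ g = a ^+ (r ^ j))%g ->
  (forall x, x ^+ P = 1 -> ev x (A f) = (x \in image E B)%:R) ->
  forall x, x ^+ P = 1 -> ev x (gelt F g^-1 * A f * gelt F g) =
    (x \in image E (B :* (unit_mod P r ^+ j)^-1)%g)%:R.
Proof.
move=> ag evB x xP1; rewrite (conj_horner _ ag) galg_eval_horner //.
rewrite map_comp_poly horner_comp map_polyXn hornerXn.
have xr1 : (x ^+ (r ^ j)) ^+ P = 1 by rewrite exprAC xP1 expr1n.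
rewrite -(galg_eval_horner order_a) // evB // -(mem_unit_rootX P_gt1 exprz_xi_prim) //.
by rewrite unit_modX // val_unit_modE ?coprimeXr // (expr_mod _ xP1).
Qed.

Lemma galg_eval_epsilon_conj g j x : (a ^ g = a ^+ (r ^ j))%g -> x ^+ P = 1 ->
  ev x (gelt F g^-1 * eps * gelt F g) =
    (x \in image E (N :* (unit_mod P r ^+ j)^-1)%g)%:R.
Proof.
rewrite epsilon_horner => ag xP1; apply: galg_eval_conj => // y yP1.
by rewrite -epsilon_horner galg_eval_epsilon.
Qed.

Lemma epsilon_conjugateP y :
  y \in undup [seq gelt F g^-1 * eps * gelt F g | g : gT] ->
  exists f v, [/\ y = A f, v \in H
    & forall x, x ^+ P = 1 -> ev x y = (x \in image E (N :* v)%g)%:R].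
Proof.
rewrite mem_undup => /imageP[g _ ->].
have [j ag] := presents_G_conj G_pres g.
exists (epsilon_poly \Po 'X^(r ^ j)), (unit_mod P r ^+ j)^-1%g; split=> [||x xP1].
- by rewrite epsilon_horner (conj_horner _ ag).
- by rewrite groupV mem_cycle.
exact: galg_eval_epsilon_conj.
Qed.

Lemma e_idem_horner : exists f, e = A f.
Proof.
rewrite /e_idem /sum_distinct_conjugates big_seq.
elim/big_ind: _ => [|_ _ [f ->] [g ->]|y /epsilon_conjugateP[f [v [-> _ _]]]].
- by exists 0; rewrite rmorph0.
- by exists (f + g); rewrite rmorphD.
by exists f.
Qed.

(** The conjugates of [epsilon] are the indicators of the cosets of [N] in NH. Equal cosets give
    equal conjugates, so the distinct ones have disjoint supports, which together cover NH. *)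
Lemma galg_eval_e_idem x : x ^+ P = 1 -> ev x e = (x \in image E (N * H)%g)%:R.
Proof.
move=> xP1; rewrite galg_eval_sum; set s := undup _.
rewrite big_seq (eq_bigr (fun y => (ev x y == 1)%:R)) => [|y]; last first.
  case/epsilon_conjugateP=> f [v [_ _ ->]] //.
  by case: (x \in _); rewrite ?eqxx // eq_sym oner_eq0.
rewrite -big_seq sum_indicator_uniq ?undup_uniq //; last first.
  move=> y y' /epsilon_conjugateP[f [v [yf Hv yE]]].
  case/epsilon_conjugateP=> f' [v' [yf' Hv' y'E]].
  rewrite /= yE // y'E //.
  case: imageP => [[u Nvu xu]|_]; last by rewrite eq_sym oner_eq0.
  case: imageP => [[u' Nvu' xu']|_ _]; last by rewrite eq_sym oner_eq0.
  (* Two conjugates with value 1 at the same x share a point of their cosets, so the cosets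
     coincide. *)
  have uu' : u = u' by apply: (unit_root_inj P_gt1 exprz_xi_prim); rewrite -xu -xu'.
  have NN : (N :* v = N :* v')%g by rewrite -(rcoset_eqP Nvu) uu' (rcoset_eqP Nvu').
  move=> _ _; rewrite yf yf'.
  apply: (horner_gelt_inj (iota := inF) order_a exprz_xi_prim) => w wP1.
  by rewrite -yf -yf' yE // y'E // NN.
congr (_%:R); congr nat_of_bool.
apply/hasP/imageP=> [[y /epsilon_conjugateP[f [v [_ Hv ->]]] //]|].
  case: imageP => [[u Nvu ->] _|_]; last by rewrite eq_sym oner_eq0.
  exists u => //; case/rcosetP: Nvu => w Nw ->; exact: mem_mulg.
case=> u /mulsgP[w v Nw Hv ->] xE.
(* Conjugation by b^j translates [N] by r^-j, so j is chosen with r^j = v^-1. *)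
have : v^-1%g \in H by rewrite groupV.
case/cycleP=> j vj; have ag := presents_G_exprj G_pres j.
exists (gelt F (b ^+ j)^-1%g * eps * gelt F (b ^+ j)%g).
  by rewrite mem_undup; apply/imageP; exists (b ^+ j)%g.
rewrite (galg_eval_epsilon_conj ag xP1) -vj invgK.
suff -> : x \in image E (N :* v)%g by [].
by apply/imageP; exists (w * v)%g => //; rewrite mem_rcoset mulgK.
Qed.

(** Conjugation translates the support NH by an element of [H], which leaves it unchanged, and the
    character values determine [e]. *)
Lemma e_idem_central g : e * gelt F g = gelt F g * e.
Proof.
suff {2}<- : gelt F g^-1 * e * gelt F g = e.
  by rewrite !mulrA -geltM mulgV gelt1 mul1r.
have [f ef] := e_idem_horner; have [j ag] := presents_G_conj G_pres g.
rewrite ef (conj_horner _ ag).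
apply: (horner_gelt_inj (iota := inF) order_a exprz_xi_prim) => x xP1.
rewrite -(conj_horner _ ag) (galg_eval_conj (B := (N <*> H)%g) ag) // -ef.
  rewrite galg_eval_e_idem // mulg_unit_cycles rcoset_id // groupV groupX //.
  by rewrite (subsetP (joing_subr _ _)) // cycle_id.
by move=> y yP1; rewrite galg_eval_e_idem // mulg_unit_cycles.
Qed.

(* The annihilator of e in F[X] is taken as a gcd, which is defined over F while its
   roots live in L. *)
Lemma e_idem_annihilator :
  exists2 g : {poly F}, (g != 0) && (size g <= #|(N * H)%g|.+1)%N & A g * e = 0.
Proof.
have [f ef] := e_idem_horner; pose g := gcdp ('X^P - 1) (1 - f).
have X0 : 'X^P - 1 != 0 :> {poly F} by rewrite -size_poly_eq0 size_XnsubC.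
have fE x : x ^+ P = 1 -> (map_poly inF f).[x] = (x \in image E (N * H)%g)%:R.
  by move=> xP1; rewrite -(galg_eval_horner order_a) // -ef galg_eval_e_idem.
have gE : map_poly inF g = gcdp ('X^P - 1) (1 - map_poly inF f).
  by rewrite gcdp_map rmorphB rmorph1 /= map_polyXn rmorphB rmorph1.
exists g; last first.
  rewrite ef -rmorphM.
  apply: (horner_gelt_eq0 (iota := inF) order_a exprz_xi_prim) => x xP1.
  rewrite rmorphM hornerM fE //; case: imageP => [xK|_]; last by rewrite mulr0.
  suff /rootP-> : root (map_poly inF g) x by rewrite mul0r.
  rewrite gE root_gcd !rootE !hornerE xP1 subrr eqxx /= fE //.
  by case: imageP => // _; rewrite subrr eqxx.
rewrite gcdp_eq0 (negPf X0) /=.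
(* Over [L], [g] divides a product of distinct linear factors, so its degree is its number of roots;
   these are also roots of 1 - f, hence lie in the image of NH. *)
have : map_poly inF g %| \prod_(0 <= i < P) ('X - (z ^+ i)%:P).
  by rewrite factor_Xn_sub_1 ?exprz_xi_prim // gE dvdp_gcdl.
rewrite -(big_map (fun i => z ^+ i) xpredT (fun x => 'X - x%:P)).
case/dvdp_prod_XsubC=> m; set s := map _ _; set t := mask m s => gt.
have s_uniq : uniq s := uniq_prim_powers exprz_xi_prim.
rewrite -(size_map_poly inF) (eqp_size gt) size_prod_XsubC ltnS.
rewrite -(size_image E); apply: uniq_leq_size; first exact: mask_uniq.
move=> x tx; have : root (map_poly inF g) x by rewrite (eqp_root gt) root_prod_XsubC.
rewrite gE root_gcd !rootE !hornerE subr_eq0 => /andP[/eqP xP1].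
by rewrite fE //; case: (x \in _); rewrite // subr0 oner_eq0.
Qed.

(** After division by the annihilator the quotient term dies against [e], and the remainder has size
    at most |NH|. *)
Lemma horner_mul_e_idem_span f :
  A f * e \in <<[seq (gelt F (a ^+ i)%g * e)%R | i <- iota 0 #|(N * H)%g|]>>%VS.
Proof.
have [g /andP[g0 szg] ge0] := e_idem_annihilator.
rewrite (divp_eq f g) rmorphD rmorphM mulrDl -mulrA ge0 mulr0 add0r.
rewrite /= horner_geltE mulr_suml; apply: memv_suml => i _.
rewrite -scalerAl memvZ // memv_span //; apply: map_f; rewrite mem_iota /=.
rewrite add0n (leq_trans (ltn_ord i)) // -ltnS.
by apply: leq_trans szg; rewrite ltn_modp.
Qed.

(** Such an f vanishes at the |NH| points where [e] takes the value 1, which exceeds its degree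
    unless f = 0. *)
Lemma horner_mul_e_idem_inj (f : {poly F}) :
  (size f <= #|(N * H)%g|)%N -> A f * e = 0 -> f = 0.
Proof.
move=> szf fe0; have [h eh] := e_idem_horner.
apply/eqP; rewrite -(map_poly_eq0 inF); apply/eqP.
apply: (@roots_geq_poly_eq0 _ _ (image E (N * H)%g)).
- apply/allP=> x xK; have xP1 := image_unit_root_expr exprz_xi_prim xK.
  have := galg_eval_horner order_a inF (f * h) xP1.
  rewrite rmorphM /= -eh fe0 rmorphM hornerM /=.
  rewrite -[X in _ * X](galg_eval_horner order_a) // -eh galg_eval_e_idem // xK mulr1.
  rewrite rootE => <-; rewrite /galg_eval big1 // => i _.
  by rewrite gcoef0 rmorph0 mul0r.
- exact: (image_unit_root_uniq P_gt1 exprz_xi_prim).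
by rewrite size_map_poly size_image.
Qed.

(** The j-th summand is supported on the coset of [<[a]>] through b^j, and these cosets are
    disjoint. *)
Lemma horner_mul_e_idem_coset (f : 'I_p -> {poly F}) :
  \sum_(j < p) A (f j) * e * gelt F (b ^+ j)%g = 0 -> forall j, A (f j) * e = 0.
Proof.
move=> S0 j0; apply/galgP=> g; rewrite gcoef0.
have [h eh] := e_idem_horner.
have [ga|] := boolP (g \in <[a]>%g); last first.
  by rewrite eh -rmorphM; apply: gcoef_horner_out.
move/galgP/(_ (g * b ^+ j0)%g): S0; rewrite gcoef0 gcoef_sum (bigD1 j0) //= big1.
  by rewrite addr0 gcoef_mul_elt mulgK.
move=> j nj; rewrite gcoef_mul_elt eh -rmorphM; apply: gcoef_horner_out.
apply: contra nj; rewrite -mulgA groupMl // => bj.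
have [_ ob tiab] := presents_G_orders p_pr n_ge2 G_pres.
have : (b ^+ j0 * (b ^+ j)^-1)%g \in (<[a]> :&: <[b]>)%g.
  by rewrite inE bj groupM ?groupV ?mem_cycle.
rewrite tiab inE -eq_mulgV1 eq_expg_mod_order ob !modn_small //.
by rewrite eq_sym.
Qed.

(** * Dimension and basis of the ideal *)

Local Notation FGe := (left_ideal_gen e).
Local Notation basis_family :=
  [seq gelt F (a ^+ i * b ^+ j)%g * e | i <- iota 0 #|(N * H)%g|, j <- iota 0 p].

Lemma e_idem_ideal_basis :
  \dim FGe = (#|(N * H)%g| * p)%N /\ basis_of FGe basis_family.
Proof.
set D := #|_|.
have szB : size basis_family = (D * p)%N by rewrite size_allpairs !size_iota.
have dimB : (D * p <= \dim FGe)%N.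
  have -> : (D * p)%N = #|{: 'I_D * 'I_p}| by rewrite card_prod !card_ord.
  apply: (@leq_dim_free_family _ _ _
    (fun ij : 'I_D * 'I_p => gelt F (a ^+ ij.1 * b ^+ ij.2)%g * e)) => [ij|c S0].
    by apply/left_ideal_genP; exists (gelt F (a ^+ ij.1 * b ^+ ij.2)%g).
  (* The coefficients attached to a fixed power of b are gathered into one polynomial of size at
     most D. *)
  pose f (j : 'I_p) : {poly F} := \sum_(i < D) c (i, j) *: 'X^i.
  have fE j : A (f j) = \sum_(i < D) c (i, j) *: gelt F (a ^+ i)%g.
    rewrite linear_sum; apply: eq_bigr => i _.
    by rewrite linearZ /= mulr_algl rmorphXn /= horner_algX gelt_expg.
  have f0 j : f j = 0.
    apply: horner_mul_e_idem_inj.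
      apply: (leq_trans (size_sum _ _ _)); apply/bigmax_leqP => i _.
      by rewrite (leq_trans (size_scale_leq _ _)) // size_polyXn.
    move: j; apply: horner_mul_e_idem_coset; rewrite -[RHS]S0.
    transitivity (\sum_(j < p) \sum_(i < D)
        c (i, j) *: (gelt F (a ^+ i * b ^+ j)%g * e)).
      apply: eq_bigr => j _; rewrite fE !mulr_suml; apply: eq_bigr => i _.
      by rewrite -!scalerAl -mulrA e_idem_central mulrA -geltM.
    by rewrite exchange_big pair_bigA; apply: eq_bigr => -[].
  case=> i j; have := congr1 (fun g : {poly F} => g`_i) (f0 j).
  rewrite coef0 coef_sum (bigD1 i) //= big1.
    by rewrite coefZ coefXn eqxx mulr1 addr0.
  by move=> l li; rewrite coefZ coefXn eq_sym (inj_eq val_inj) (negPf li) mulr0.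
have spanB : (FGe <= <<basis_family>>)%VS.
  apply/subvP=> _ /left_ideal_genP[y ->]; rewrite [y]galg_sum mulr_suml.
  apply: memv_suml => g _; rewrite -scalerAl memvZ //.
  have /mulsgP[_ _ /cycleP[i ->] /cycleP[j ->] ->] : g \in (<[a]> * <[b]>)%g.
    by rewrite (presents_G_mul G_pres) inE.
  have [_ ob _] := presents_G_orders p_pr n_ge2 G_pres.
  (* Centrality moves b^j to the right of [e], so that a^i e can be rewritten in the span of the
     first D powers of a times [e] before b^j is moved back. *)
  rewrite geltM -mulrA -e_idem_central mulrA gelt_expg.
  rewrite -(horner_algX (gelt F a)) -rmorphXn.
  rewrite -(expg_mod_order b) ob.
  have j_lt : (j %% p < p)%N by rewrite ltn_mod prime_gt0.
  move: (j %% p)%N j_lt => l l_lt.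
  have := memv_img (amulr (gelt F (b ^+ l)%g)) (horner_mul_e_idem_span 'X^i).
  rewrite limg_span lfunE /=; apply/subvP/span_subvP => _ /mapP[_ /mapP[t tD ->] ->].
  rewrite lfunE /= -mulrA e_idem_central mulrA -geltM memv_span //.
  apply: (@allpairs_f _ _ _ (fun i j => gelt F (a ^+ i * b ^+ j)%g * e)) => //.
  by rewrite mem_iota.
split; last by rewrite basisEdim spanB szB.
apply/eqP; rewrite eqn_leq dimB -szB andbT.
exact: leq_trans (dimvS spanB) (dim_span _).
Qed.

(** * The order of NH in terms of w0 *)

(** The congruence r = 1 mod p^(n-1) lifts to r^p = 1 mod p^n, and 1 < r < p^n excludes order 1. *)
Lemma order_unit_mod_twist : #[unit_mod P r]%g = p.
Proof.
have p_gt1 := prime_gt1 p_pr.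
have n1 : n = n.-1.+1 by rewrite prednK // (leq_trans _ n_ge2).
have n1_gt0 : (0 < n.-1)%N by rewrite -ltnS -n1.
apply: nt_prime_order => //.
  apply/eqP; rewrite unit_modX // unit_mod_eq1 ?coprimeXr //; apply/eqP.
  rewrite {2 3}n1; apply: expn_p_mod => //.
  by rewrite addnC -{1}[(p ^ n.-1)%N]mul1n modnMDl.
have pn1_gt1 : (1 < p ^ n.-1)%N by rewrite -(exp1n n.-1) ltn_exp2r.
rewrite unit_mod_eq1 // !modn_small //.
  by rewrite -[X in _ == X]addn0 eqn_add2l -lt0n ltnW.
rewrite {2}n1 expnS; apply: leq_trans (_ : 2 * p ^ n.-1 <= _)%N.
  by rewrite mul2n -addnn ltn_add2r.
by rewrite leq_mul2r p_gt1 orbT.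
Qed.

(** Since [H] has prime order p, either it lies in [N] and w0 = 1, or it meets [N] trivially and p
    divides w0. In both cases gcd(w0, p) is the index of [N] in NH. *)
Lemma card_mul_unit_cycles w0 : (0 < w0)%N -> (unit_mod P r ^+ w0 \in N)%g ->
  (forall w, (0 < w)%N -> (unit_mod P r ^+ w \in N)%g -> (w0 <= w)%N) ->
  #|(N * H)%g| = (gcdn w0 p * #[unit_mod P #|F|]%g)%N.
Proof.
move=> w0_gt0 w0_in w0_min.
have [rN|rN] := boolP (unit_mod P r \in N).
  have -> : w0 = 1%N by apply/eqP; rewrite eqn_leq w0_gt0 w0_min // expg1.
  by rewrite gcd1n mul1n mulGSid // cycle_subG.
have tiNH : (N :&: H = 1)%g.
  by rewrite setIC prime_TIg ?cycle_subG // -orderE order_unit_mod_twist.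
have : (unit_mod P r ^+ w0 \in N :&: H)%g by rewrite inE w0_in mem_cycle.
rewrite tiNH inE -order_dvdn order_unit_mod_twist => p_w0.
by rewrite TI_cardMg // -!orderE order_unit_mod_twist (gcdn_idPr p_w0) mulnC.
Qed.

(** * Weights and minimum distance *)

Lemma e_idem_in_ideal : e \in FGe.
Proof. by apply/left_ideal_genP; exists 1; rewrite mul1r. Qed.

Lemma e_idem_neq0 : e != 0.
Proof.
apply/eqP=> e0; have := galg_eval_e_idem zP1.
rewrite e0 /galg_eval big1 => [|i _]; last first.
  by rewrite gcoef0 rmorph0 mul0r.
suff -> : z \in image E (N * H)%g by move/eqP; rewrite eq_sym oner_eq0.
by apply/imageP; exists 1%g; rewrite ?mulg_unit_cycles ?group1 // unit_root1.
Qed.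

(** Since [e] lies in F<a>, its augmentation is its value at x = 1, and no z^u equals 1. *)
Lemma sum_gcoef_e_idem : \sum_g gcoef e g = 0.
Proof.
have [f ef] := e_idem_horner.
have -> : \sum_g gcoef e g = \sum_(g in <[a]>%g) gcoef e g.
  rewrite [RHS]big_mkcond; apply: eq_bigr => g _.
  by case: ifP => // /negbT a'g; rewrite ef gcoef_horner_out.
rewrite big_cycle order_a; apply: (fmorph_inj inF); rewrite rmorph0 rmorph_sum.
have := galg_eval_e_idem (expr1n _ P); rewrite /galg_eval.
under eq_bigr do rewrite expr1n mulr1.
move=> ->; case: imageP => // -[u _ /esym/eqP].
by rewrite (negPf (unit_root_neq1 P_gt1 exprz_xi_prim u)).
Qed.

Lemma e_idem_ideal_weight_ge2 x : x \in FGe -> x != 0 -> (2 <= weight x)%N.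
Proof.
case/left_ideal_genP=> y xE x0.
have S0 : \sum_g gcoef x g = 0 by rewrite xE sum_gcoefM sum_gcoef_e_idem mulr0.
have [g xg] : exists g, gcoef x g != 0.
  apply/existsP; apply: contraNT x0 => /existsPn x0; apply/eqP/galgP=> g.
  by rewrite gcoef0; apply/eqP; rewrite -[_ == _]negbK x0.
rewrite /weight ltnNge; apply/negP=> /card_le1_eqP supp1; case/eqP: (xg).
rewrite -[RHS]S0 (bigD1 g) //= big1 ?addr0 // => h hg.
apply/eqP; apply: contraNT hg => xh.
by apply/eqP; apply: supp1; rewrite inE.
Qed.

Lemma weight_e_idem_leq : (weight e <= P)%N.
Proof.
have [f ef] := e_idem_horner; rewrite -order_a; apply: weight_leq => g.
by apply: contraR => a'g; rewrite ef gcoef_horner_out.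
Qed.

(** Each substitution u -> u(1 + p^i0 t) preserves [N]. Summing over t < p^(n-i0) attaches to each u
    a geometric sum with ratio z^(u p^i0 i), which vanishes because that ratio is not 1. *)
Lemma root_trace_eq0 i0 i : (0 < i0 <= n)%N ->
  (p ^ (n - i0) %| #[unit_mod P #|F|]%g)%N -> ~~ (p ^ (n - i0) %| i)%N ->
  root_trace i = 0.
Proof.
move=> i0n dvdN ndvd_i; have /andP[i0_gt0 le_i0n] := i0n.
set M := (p ^ (n - i0))%N in dvdN ndvd_i.
have MP : (p ^ i0 * M = P)%N by rewrite -expnD subnKC.
(* [M] divides P, which is nonzero in [L], so it suffices to kill [M] times the trace. *)
have M0 : M%:R != 0 :> L.
  by apply: prim_root_dvd_eq0 xi_prim _ _; rewrite -MP dvdn_mull.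
apply: (fmorph_inj inF); rewrite rmorph0 /= root_traceE; apply: (mulfI M0).
rewrite mulr0 mulr_natl -[M in LHS]card_ord -sumr_const.
pose v t := unit_mod P (1 + p ^ i0 * t).
transitivity (\sum_(t < M) \sum_(u in N) E u ^+ i * (E u ^+ (p ^ i0 * i)) ^+ t).
  apply: eq_bigr => t _; rewrite (reindex_inj (mulIg (v t))) /=.
  apply: eq_big => [u|u _]; first by rewrite groupMr // mem_cycle_1add.
  rewrite (unit_rootM_mod P_gt1 exprz_xi_prim) ?coprime_1add // -2!(exprM (E u)) -exprD.
  by congr (_ ^+ _); rewrite mulnDl mul1n (mulnAC _ t i).
rewrite exchange_big big1 // => u _ /=; rewrite -mulr_sumr sum_expr_root1.
  suff /negPf-> : E u ^+ (p ^ i0 * i) != 1 by rewrite mul0r mulr0.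
  apply: contra ndvd_i => /eqP w1.
  have : (P %| p ^ i0 * i)%N.
    rewrite (prim_order_dvd exprz_xi_prim) -{1}(unit_root1 P z) -(mulgV u).
    by rewrite (unit_rootM P_gt1 exprz_xi_prim) exprAC w1 expr1n.
  by rewrite -MP dvdn_pmul2l // expn_gt0 prime_gt0.
by rewrite -exprM mulnAC MP exprM (unit_root_expr exprz_xi_prim) expr1n.
Qed.

(** Here [H] lies in [N], so [epsilon] is already [e], and its surviving coefficients sit on the
    subgroup generated by a^(p^(n-i0)), of order p^i0. *)
Lemma weight_e_idem_leq_i0 i0 : (0 < i0 < n)%N ->
  (p ^ (n - i0) %| #[unit_mod P #|F|]%g)%N -> (weight e <= p ^ i0)%N.
Proof.
move=> /andP[i0_gt0 lt_i0n] dvdN; have le_i0n := ltnW lt_i0n.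
(* As i0 <= n - 1, p divides the order of q, which is what membership of 1 + p^(n-1) requires. *)
have rN : unit_mod P r \in N.
  have -> : r = (1 + p ^ n.-1 * 1)%N by rewrite muln1.
  have n1 : n = n.-1.+1 by rewrite prednK // (leq_trans _ n_ge2).
  apply: mem_cycle_1add => //; first by rewrite leq_pred andbT -ltnS -n1.
  apply: dvdn_trans dvdN; apply: dvdn_exp2l; apply: leq_sub2l.
  by rewrite -ltnS -n1.
have -> : e = eps.
  have [f ef] := e_idem_horner; rewrite ef epsilon_horner.
  apply: (horner_gelt_inj (iota := inF) order_a exprz_xi_prim) => x xP1.
  rewrite -ef -epsilon_horner galg_eval_e_idem // galg_eval_epsilon //.
  by rewrite mulGSid // cycle_subG.
have <- : #[a ^+ (p ^ (n - i0))]%g = (p ^ i0)%N.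
  have PE : P = (p ^ i0 * p ^ (n - i0))%N by rewrite -expnD subnKC.
  rewrite orderXdiv order_a PE ?dvdn_mull //.
  by rewrite mulnK // expn_gt0 prime_gt0.
apply: weight_leq => g; apply: contraR => ag.
rewrite gcoefZ gcoef_sum big1 ?mulr0 // => i _; rewrite gcoefZ gcoef_elt.
have [/dvdnP[j ij]|ndvd_i] := boolP (p ^ (n - i0) %| i)%N.
  case: eqP => [gi|_]; last by rewrite mulr0.
  by case/negP: ag; rewrite gi groupV ij mulnC expgM mem_cycle.
have -> : Ftrace xi (xi ^ (k * (i : nat)%:Z)) = root_trace i.
  by rewrite /root_trace -exprz_exp.
by rewrite (@root_trace_eq0 i0) ?mul0r ?i0_gt0.
Qed.

Lemma e_idem_ideal_min_distance B :
  (exists2 x, x \in FGe & x != 0 /\ (weight x <= B)%N) ->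
  exists2 d, is_min_distance FGe d & (2 <= d <= B)%N.
Proof.
case=> x0 Ux0 [x0_neq0 x0_B].
(* Viewing elements as finite functions gives a predicate on a finite type, where a minimiser
   exists. *)
pose Q (x : {ffun gT -> F}) := ((x : galg F gT) \in FGe) && ((x : galg F gT) != 0).
have Qx0 : Q x0 by rewrite /Q Ux0.
case: (@arg_minnP _ (x0 : {ffun gT -> F}) Q (fun x => weight (x : galg F gT)) Qx0).
move=> x /andP[Ux x_neq0] minx; exists (weight x).
  by split=> [|y Uy y_neq0]; [exists x | apply: minx; rewrite /Q Uy].
by rewrite e_idem_ideal_weight_ge2 // (leq_trans (minx _ Qx0)).
Qed.

End Idempotent.

Theorem corollary4p3
  (p n q : nat) (F : finFieldType) (gT : finGroupType) (a b : gT)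
  (L : splittingFieldType F) (xi : L) (k : int)
  (i0 delta delta' w0 : nat)
  (p_prime : prime p) (p_odd : odd p) (n_ge2 : (2 <= n)%N)
  (G_pres : presents_G p n a b)
  (card_F : #|F| = q) (q_p_coprime : coprime q p)
  (xi_prim : (p ^ n).-primitive_root xi)
  (k_p_coprime : coprimez k p%:Z)
  (i0_range : (1 <= i0 <= n)%N)
  (delta_def : (mult_order (p ^ n) q * delta = totient (p ^ n))%N)
  (delta_fact : delta = (p ^ i0.-1 * delta')%N)
  (delta'_coprime : coprime delta' p)
  (w0_gt0 : (0 < w0)%N)
  (w0_in : (unit_mod (p ^ n) (1 + p ^ n.-1) ^+ w0
              \in <[unit_mod (p ^ n) q]>)%g)
  (w0_min : forall w : nat, (0 < w)%N ->
     (unit_mod (p ^ n) (1 + p ^ n.-1) ^+ w \in <[unit_mod (p ^ n) q]>)%g ->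
     (w0 <= w)%N) :
  let o := mult_order (p ^ n) q in
  let e : galg F gT := e_idem a p n xi k in
  let FGe := left_ideal_gen e in
  [/\ \dim FGe = (p * o * gcdn w0 p)%N,
      basis_of FGe
        [seq gelt F (a ^+ i * b ^+ j)%g * e
           | i <- iota 0 (gcdn w0 p * o), j <- iota 0 p]
    & exists2 d : nat, is_min_distance FGe d
        & if (n <= i0)%N then (2 <= d <= p ^ n)%N else (2 <= d <= p ^ i0)%N].
Proof.
subst q; move=> o e FGe.
have co_w : #|(<[unit_mod (p ^ n) #|F|]> * <[unit_mod (p ^ n) (1 + p ^ n.-1)]>)%g|
    = (gcdn w0 p * o)%N by apply: card_mul_unit_cycles.
have [dimE basisE] := e_idem_ideal_basis p_prime p_odd n_ge2 G_pres
  q_p_coprime xi_prim k_p_coprime.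
rewrite co_w in dimE basisE; split=> //.
  by rewrite dimE mulnC [(gcdn w0 p * o)%N]mulnC mulnA.
have min_dist B : (weight e <= B)%N ->
    exists2 d, is_min_distance FGe d & (2 <= d <= B)%N.
  move=> eB; apply: (e_idem_ideal_min_distance p_prime n_ge2 G_pres) => //.
  exists e; first exact: e_idem_in_ideal.
  by split=> //; apply: (e_idem_neq0 p_prime p_odd n_ge2 G_pres).
case: leqP => [_|lt_i0n]; apply: min_dist.
  exact: (weight_e_idem_leq p_prime n_ge2 G_pres).
have /andP[i0_gt0 le_i0n] := i0_range.
apply: (weight_e_idem_leq_i0 p_prime p_odd n_ge2 G_pres) => //.
  by rewrite i0_gt0.
(* It remains that p^(n-i0) divides o. In o * delta = p^(n-1) (p - 1), the factor p^(i0-1) of delta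
   cancels, and delta' is coprime to p. *)
have co_M : coprime (p ^ (n - i0)) delta' by rewrite coprimeXl // coprime_sym.
have pi_gt0 : (0 < p ^ i0.-1)%N by rewrite expn_gt0 prime_gt0.
rewrite -(Gauss_dvdl _ co_M) -(dvdn_pmul2l pi_gt0) mulnCA -delta_fact.
rewrite [(_ * delta)%N]delta_def totient_pfactor ?(leq_trans _ n_ge2) //.
rewrite -expnD (_ : i0.-1 + (n - i0) = n.-1)%N ?dvdn_mull //.
rewrite addnBA // -{2}(prednK i0_gt0).
by rewrite -(prednK (ltn_trans i0_gt0 lt_i0n)) addnS subSS addKn.
Qed.
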